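(* Let $A,B\in\mathbb{C}^{n\times n}$ with $B$ sectorial. Then $I+AB$ is invertible if there exists $r\ge0$ such that $A$ is $r$-sectorial and $$\bar\psi_r(A)+\bar\phi(B)<\pi,\qquad \underline\psi_r(A)+\underline\phi(B)>-\pi,\qquad \bar\sigma(B)\,r<1.$$
   Context: $\bar\sigma$: largest singular value. Numerical range $\mathcal{W}(B)=\{x^*Bx:\|x\|=1\}$; $B$ is sectorial if $0\notin\mathcal W(B)$, then $B=T^*DT$ with $T$ nonsingular, $D$ diagonal unitary, and the phases $\bar\phi(B)\ge\dots\ge\underline\phi(B)$ are the arguments of the diagonal entries of $D$ chosen with $\bar\phi(B)-\underline\phi(B)<\pi$ and $(\bar\phi(B)+\underline\phi(B))/2\in(-\pi,\pi]$. $\mathcal{DW}(A)=\{(\mathrm{Re}\,x^*Ax,\mathrm{Im}\,x^*Ax,\|Ax\|^2):\|x\|=1\}$, $\mathcal{W}_{\ge r}(A)=\{(p,q):(p,q,h^2)\in\mathcal{DW}(A),\ h\ge r\}$; $A$ is $r$-sectorial if $(0,0)\notin\mathcal{W}_{\ge r}(A)$. For $r$-sectorial $A$ with $r\le\bar\sigma(A)$: $\underline\psi_r(A)=\min\{\angle z:(\mathrm{Re}\,z,\mathrm{Im}\,z)\in\mathcal{W}_{\ge r}(A)\}$, $\bar\psi_r(A)=\max\{\angle z:(\mathrm{Re}\,z,\mathrm{Im}\,z)\in\mathcal{W}_{\ge r}(A)\}$, angles on a branch with $(\underline\psi_r+\bar\psi_r)/2\in(-\pi,\pi]$, $\bar\psi_r-\underline\psi_r\in(0,\pi]$;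 for $r>\bar\sigma(A)$, by convention $\underline\psi_r(A)=+\infty$, $\bar\psi_r(A)=-\infty$. *)

(* Defs.v *)
From mathcomp Require Import all_boot all_order all_algebra.
From mathcomp Require Import all_classical all_reals all_analysis.
From mathcomp Require Export complex.
Set Implicit Arguments. Unset Strict Implicit. Unset Printing Implicit Defensive.
Import Order.TTheory GRing.Theory Num.Theory.
Local Open Scope ring_scope.
Local Open Scope classical_set_scope.

Section Defs.
Variable R : realType.
Local Notation C := R[i].

Definition adjmx m n (M : 'M[C]_(m, n)) : 'M[C]_(n, m) := (map_mx Num.conj M)^T.

Definition qform n (B : 'M[C]_n) (x : 'cV[C]_n) : C := (adjmx x *m B *m x) 0 0.

Definition sqnorm n (x : 'cV[C]_n) : R := complex.Re ((adjmx x *m x) 0 0).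

Definition numrange n (B : 'M[C]_n) : set C :=
  [set z | exists x : 'cV[C]_n, sqnorm x = 1 /\ z = qform B x].

Definition sectorial n (B : 'M[C]_n) : Prop := ~ numrange B 0.

Definition expi (t : R) : C := Complex (cos t) (sin t).

Definition phase_bounds n (B : 'M[C]_n) (pmax pmin : R) : Prop :=
  exists (T : 'M[C]_n) (th : 'I_n -> R),
    [/\ T \in unitmx,
        B = adjmx T *m diag_mx (\row_k expi (th k)) *m T,
        (forall k, pmin <= th k <= pmax),
        (exists k, th k = pmax) /\ (exists k, th k = pmin) &
        pmax - pmin < pi /\ - pi < (pmax + pmin) / 2 <= pi].

Definition phase_max n (B : 'M[C]_n) : R :=
  (xget (0, 0) [set p : R * R | phase_bounds B p.1 p.2]).1.
Definition phase_min n (B : 'M[C]_n) : R :=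
  (xget (0, 0) [set p : R * R | phase_bounds B p.1 p.2]).2.

Definition sigma_max n (B : 'M[C]_n) : R :=
  xget 0 [set s : R | [/\ 0 <= s,
     eigenvalue (adjmx B *m B) (Complex (s ^+ 2) 0) &
     forall a : C, eigenvalue (adjmx B *m B) a -> a <= Complex (s ^+ 2) 0]].

(* W_{>= r}(A) = {(p,q) : (p,q,h^2) in DW(A), h >= r},
   DW(A) = {(Re x^*Ax, Im x^*Ax, ||Ax||^2) : ||x|| = 1} *)
Definition Wge n (r : R) (A : 'M[C]_n) : set (R * R) :=
  [set pq | exists (x : 'cV[C]_n) (h : R),
     [/\ sqnorm x = 1, pq.1 = complex.Re (qform A x), pq.2 = complex.Im (qform A x),
         h ^+ 2 = sqnorm (A *m x) & r <= h]].

Definition r_sectorial n (r : R) (A : 'M[C]_n) : Prop := ~ Wge r A (0, 0).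

Definition angle_of (pq : R * R) (t : R) : Prop :=
  exists rho : R, [/\ 0 < rho, pq.1 = rho * cos t & pq.2 = rho * sin t].

Definition psi_bounds n (r : R) (A : 'M[C]_n) (lo hi : R) : Prop :=
  [/\ (forall pq, Wge r A pq -> exists2 t, lo <= t <= hi & angle_of pq t),
      (exists2 pq, Wge r A pq & angle_of pq lo),
      (exists2 pq, Wge r A pq & angle_of pq hi),
      - pi < (lo + hi) / 2 <= pi &
      0 <= hi - lo <= pi].

Definition psi_lo n (r : R) (A : 'M[C]_n) : \bar R :=
  if r <= sigma_max A then
    ((xget (0, 0) [set p : R * R | psi_bounds r A p.1 p.2]).1)%:E
  else +oo%E.

Definition psi_hi n (r : R) (A : 'M[C]_n) : \bar R :=
  if r <= sigma_max A then
    ((xget (0, 0) [set p : R * R | psi_bounds r A p.1 p.2]).2)%:E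
  else -oo%E.

End Defs.

(* Main.v *)
Require Import Defs.
From mathcomp Require Import all_boot all_order all_algebra.
From mathcomp Require Import all_classical all_reals all_analysis.
From mathcomp Require Import complex.
From mathcomp Require Import sesquilinear spectral.
From mathcomp Require Import ring lra.
Import Order.TTheory GRing.Theory Num.Theory.
Import numFieldNormedType.Exports.
Local Open Scope ring_scope.

(** If [I + AB] is singular, pick [x <> 0] with [ABx = -x] and put [y = Bx].  Then
    [y^*Ay = - conj (x^*Bx)], while [|y| <= sigma_max B * |x|] and
    [sigma_max B * r < 1] give [|Ay| >= r |y|], so that the normalized [y] yields a
    point of [W_{>= r}(A)].  Its argument [t] lies in [[psi_lo, psi_hi]], and
    [x^*Bx] is a nonnegative combination of the [e^(i th_k)] with [th_k] between
    [phase_min B] and [phase_max B]; the angle conditions prevent such a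
    combination from pointing in the direction [- e^(-it)].

    Since [psi_lo], [psi_hi], [phase_max], [phase_min] and [sigma_max] are chosen by
    [xget], the existence of the quantities they denote has to be proved.  For
    the angles this rests on [W_{>= r}(A)] being compact and convex.  Convexity
    is Toeplitz-Hausdorff with one extra inequality: on the span of two vectors
    all three quadratic forms involved are linear in the Hopf coordinates. *)

Set Implicit Arguments. Unset Strict Implicit. Unset Printing Implicit Defensive.

Local Notation Re := complex.Re.
Local Notation Im := complex.Im.

(** * Adjoints and quadratic forms of complex matrices *)

Section Forms.
Variable R : realType.
Local Notation C := R[i].
Implicit Types (n : nat) (z w : C).

Lemma conjCE (z : C) : Num.conj z = Complex (Re z) (- Im z).
Proof. by case: z. Qed.

Lemma ReD z w : Re (z + w) = Re z + Re w. Proof. by case: z; case: w. Qed.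
Lemma ImD z w : Im (z + w) = Im z + Im w. Proof. by case: z; case: w. Qed.
Lemma ReN z : Re (- z) = - Re z. Proof. by case: z. Qed.
Lemma ImN z : Im (- z) = - Im z. Proof. by case: z. Qed.
Lemma ReM z w : Re (z * w) = Re z * Re w - Im z * Im w.
Proof. by case: z; case: w. Qed.
Lemma ImM z w : Im (z * w) = Re z * Im w + Im z * Re w.
Proof. by case: z; case: w. Qed.
Lemma complex_ext z w : Re z = Re w -> Im z = Im w -> z = w.
Proof. by case: z; case: w => ? ? ? ? /= -> ->. Qed.
Definition ReImE := (ReD, ImD, ReN, ImN, ReM, ImM, conjCE).

Lemma Re_sum I (r : seq I) (P : pred I) (F : I -> C) :
  Re (\sum_(i <- r | P i) F i) = \sum_(i <- r | P i) Re (F i).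
Proof. by apply: (big_morph _ ReD). Qed.
Lemma Im_sum I (r : seq I) (P : pred I) (F : I -> C) :
  Im (\sum_(i <- r | P i) F i) = \sum_(i <- r | P i) Im (F i).
Proof. by apply: (big_morph _ ImD). Qed.

Lemma adjmxE m n (M : 'M[C]_(m, n)) i j : adjmx M i j = Num.conj (M j i).
Proof. by rewrite !mxE. Qed.
Lemma adjmxK m n (M : 'M[C]_(m, n)) : adjmx (adjmx M) = M.
Proof. by apply/matrixP => i j; rewrite !adjmxE conjCK. Qed.
Lemma adjmxM m n p (M : 'M[C]_(m, n)) (N : 'M[C]_(n, p)) :
  adjmx (M *m N) = adjmx N *m adjmx M.
Proof. by rewrite /adjmx map_mxM trmx_mul. Qed.
Lemma adjmxD m n (M N : 'M[C]_(m, n)) : adjmx (M + N) = adjmx M + adjmx N.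
Proof. by rewrite /adjmx map_mxD linearD. Qed.
Lemma adjmxN m n (M : 'M[C]_(m, n)) : adjmx (- M) = - adjmx M.
Proof. by rewrite /adjmx map_mxN linearN. Qed.
Lemma adjmxZ m n a (M : 'M[C]_(m, n)) : adjmx (a *: M) = Num.conj a *: adjmx M.
Proof. by rewrite /adjmx map_mxZ linearZ. Qed.
Lemma adjmx1 n : adjmx (1%:M : 'M[C]_n) = 1%:M.
Proof. by rewrite /adjmx map_mx1 trmx1. Qed.

Lemma addmx_entry m n (M N : 'M[C]_(m, n)) i j : (M + N) i j = M i j + N i j.
Proof. by rewrite mxE. Qed.
Lemma scalemx_entry m n a (M : 'M[C]_(m, n)) i j : (a *: M) i j = a * M i j.
Proof. by rewrite mxE. Qed.

(** The sesquilinear form behind [qform]; its cross terms appear when [qform] is expanded on the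
    span of two vectors. *)
Definition sform n (B : 'M[C]_n) (x y : 'cV[C]_n) : C :=
  (adjmx x *m B *m y) 0 0.

Lemma qform_sform n (B : 'M[C]_n) x : qform B x = sform B x x. Proof. by []. Qed.
Lemma sformDl n (B : 'M[C]_n) x x' y : sform B (x + x') y = sform B x y + sform B x' y.
Proof. by rewrite /sform adjmxD !mulmxDl addmx_entry. Qed.
Lemma sformDr n (B : 'M[C]_n) x y y' : sform B x (y + y') = sform B x y + sform B x y'.
Proof. by rewrite /sform mulmxDr addmx_entry. Qed.
Lemma sformZl n (B : 'M[C]_n) a x y : sform B (a *: x) y = Num.conj a * sform B x y.
Proof. by rewrite /sform adjmxZ -!scalemxAl scalemx_entry. Qed.
Lemma sformZr n (B : 'M[C]_n) a x y : sform B x (a *: y) = a * sform B x y.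
Proof. by rewrite /sform -scalemxAr scalemx_entry. Qed.

Lemma qform_comb n (B : 'M[C]_n) (x y : 'cV[C]_n) (a b : C) :
  qform B (a *: x + b *: y) =
  Num.conj a * a * qform B x + Num.conj b * b * qform B y
  + Num.conj a * b * sform B x y + Num.conj b * a * sform B y x.
Proof.
rewrite !qform_sform sformDl !sformDr !sformZl !sformZr.
move: (sform B x x) (sform B x y) (sform B y x) (sform B y y) => p q u v.
by move: (Num.conj a) (Num.conj b) => a' b'; ring.
Qed.

Lemma qformZ n (B : 'M[C]_n) (x : 'cV[C]_n) (a : C) :
  qform B (a *: x) = Num.conj a * a * qform B x.
Proof. by rewrite !qform_sform sformZl sformZr mulrA. Qed.

Lemma qformD n (B D : 'M[C]_n) x : qform (B + D) x = qform B x + qform D x.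
Proof. by rewrite /qform mulmxDr mulmxDl mxE. Qed.
Lemma qformN n (B : 'M[C]_n) x : qform (- B) x = - qform B x.
Proof. by rewrite /qform mulmxN mulNmx mxE. Qed.
Lemma qformZl n (B : 'M[C]_n) a x : qform (a *: B) x = a * qform B x.
Proof. by rewrite /qform -scalemxAr -scalemxAl mxE. Qed.

Lemma qform_conj n (B : 'M[C]_n) x : qform (adjmx B) x = Num.conj (qform B x).
Proof.
by rewrite /qform -[RHS](adjmxE (adjmx x *m B *m x)) !adjmxM adjmxK mulmxA.
Qed.

Lemma qform_mulmx n (B T : 'M[C]_n) x :
  qform (adjmx T *m B *m T) x = qform B (T *m x).
Proof. by rewrite /qform adjmxM !mulmxA. Qed.

Lemma qform_diag n (d : 'rV[C]_n) x :
  qform (diag_mx d) x = \sum_i d 0 i * (Num.conj (x i 0) * x i 0).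
Proof.
rewrite /qform -mulmxA mul_diag_mx mxE; apply: eq_bigr => i _.
by rewrite adjmxE !mxE mulrCA.
Qed.

Lemma qform1 n (x : 'cV[C]_n) : qform 1%:M x = (adjmx x *m x) 0 0.
Proof. by rewrite /qform mulmx1. Qed.

Lemma sqnorm_sum n (x : 'cV[C]_n) :
  sqnorm x = \sum_i (Re (x i 0) ^+ 2 + Im (x i 0) ^+ 2).
Proof.
rewrite /sqnorm mxE Re_sum; apply: eq_bigr => i _.
by rewrite adjmxE !ReImE /=; ring.
Qed.

Lemma qform1_sqnorm n (x : 'cV[C]_n) : qform 1%:M x = Complex (sqnorm x) 0.
Proof.
apply: complex_ext; rewrite qform1 //= mxE Im_sum big1// => i _.
by rewrite adjmxE !ReImE /=; ring.
Qed.

Lemma qform_gram n (A : 'M[C]_n) x :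
  qform (adjmx A *m A) x = Complex (sqnorm (A *m x)) 0.
Proof. by rewrite -qform1_sqnorm -qform_mulmx mulmx1. Qed.

Lemma sqnorm_ge0 n (x : 'cV[C]_n) : 0 <= sqnorm x.
Proof. by rewrite sqnorm_sum sumr_ge0// => i _; rewrite addr_ge0 ?sqr_ge0. Qed.

Lemma sqnorm_eq0 n (x : 'cV[C]_n) : (sqnorm x == 0) = (x == 0).
Proof.
apply/eqP/eqP => [|->]; last first.
  by rewrite sqnorm_sum big1// => i _; rewrite mxE /=; ring.
rewrite sqnorm_sum => /eqP; rewrite psumr_eq0 => [/allP x0|i _]; last first.
  by rewrite addr_ge0 ?sqr_ge0.
apply/matrixP => i j; rewrite ord1 mxE.
have /eqP := x0 i (mem_index_enum _) => /eqP.
rewrite paddr_eq0 ?sqr_ge0// !sqrf_eq0 => /andP[/eqP r0 /eqP i0].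
exact: complex_ext.
Qed.

Lemma sqnorm_gt0 n (x : 'cV[C]_n) : (0 < sqnorm x) = (x != 0).
Proof. by rewrite lt_def sqnorm_ge0 andbT sqnorm_eq0. Qed.

Lemma sqnormZ n a (x : 'cV[C]_n) :
  sqnorm (a *: x) = (Re a ^+ 2 + Im a ^+ 2) * sqnorm x.
Proof.
have := qformZ 1%:M x a; rewrite !qform1_sqnorm => /(congr1 (@complex.Re R)) /= ->.
rewrite !ReImE /=; ring.
Qed.

Lemma sqnormN n (x : 'cV[C]_n) : sqnorm (- x) = sqnorm x.
Proof. by rewrite -scaleN1r sqnormZ /=; ring. Qed.

(** * Hopf coordinates and convexity of [Wge] *)

Lemma real_relation3 (u v w : C) : exists b0 b1 b2 : R,
  [|| b0 != 0, b1 != 0 | b2 != 0] /\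
  Complex b0 0 * u + Complex b1 0 * v + Complex b2 0 * w = 0.
Proof.
pose M : 'M[R]_(3, 2) := \matrix_(i < 3, j < 2)
  let z := nth 0 [:: u; v; w] i in if j == 0 :> nat then Re z else Im z.
(* The three complex numbers are the rows of a real 3 x 2 matrix, whose left kernel is nonzero by
   rank. *)
have kM : kermx M != 0.
  by rewrite -mxrank_eq0 mxrank_ker subn_eq0 -ltnNge ltnS rank_leq_col.
have /rowV0Pn[b /sub_kermxP bM b0] := kM.
exists (b 0 ord0), (b 0 (lift ord0 ord0)), (b 0 (lift ord0 (lift ord0 ord0))); split.
  apply: contraNT b0; rewrite !negb_or !negbK => /and3P[/eqP h0 /eqP h1 /eqP h2].
  apply/eqP/matrixP => i j; rewrite ord1 mxE.
  by case: j => -[|[|[|//]]] lj; [rewrite -[RHS]h0|rewrite -[RHS]h1|rewrite -[RHS]h2];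
    congr (b _ _); apply: val_inj.
move/matrixP: bM => bM; apply: complex_ext; rewrite !ReImE /=.
- have := bM 0 0; rewrite !mxE !big_ord_recl big_ord0 !mxE /= => h; rewrite -[RHS]h.
  by ring.
- have := bM 0 1; rewrite !mxE !big_ord_recl big_ord0 !mxE /= => h; rewrite -[RHS]h.
  by ring.
Qed.

(* The Hopf map (a, b) |-> (|a|^2 - |b|^2, conj(a) b). *)
Lemma hopf_surjective (b0 b1 b2 : R) : [|| b0 != 0, b1 != 0 | b2 != 0] ->
  exists a b : C, [/\ (a != 0) || (b != 0),
    Num.conj a * a - Num.conj b * b = Complex b0 0 &
    Num.conj a * b = Complex b1 b2].
Proof.
(* [N] is the value forced on |a|^2 + |b|^2, because its square is (|a|^2 - |b|^2)^2 + 4 |conj(a)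
   b|^2. Hence |a|^2 = (N + b0) / 2, and the case N + b0 = 0, where a = 0, is treated apart. *)
move=> bn0; set N : R := Num.sqrt (b0 ^+ 2 + 4 * (b1 ^+ 2 + b2 ^+ 2)).
have s0 : 0 < b0 ^+ 2 + 4 * (b1 ^+ 2 + b2 ^+ 2).
  have s0 : 0 <= b0 ^+ 2 + 4 * (b1 ^+ 2 + b2 ^+ 2).
    by rewrite addr_ge0 ?sqr_ge0// mulr_ge0// addr_ge0 ?sqr_ge0.
  rewrite lt_def s0 andbT.
  apply: contraTN bn0; rewrite paddr_eq0 ?sqr_ge0 ?mulr_ge0 ?addr_ge0 ?sqr_ge0//.
  rewrite sqrf_eq0 mulf_eq0 pnatr_eq0 /= paddr_eq0 ?sqr_ge0// !sqrf_eq0.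
  by move=> /and3P[/eqP -> /eqP -> /eqP ->]; rewrite eqxx.
have N2 : N ^+ 2 = b0 ^+ 2 + 4 * (b1 ^+ 2 + b2 ^+ 2) by rewrite sqr_sqrtr ?ltW.
have N0 : 0 < N by rewrite sqrtr_gt0.
have Nb : 0 <= N + b0.
  have : `|b0| <= N.
    by rewrite -sqrtr_sqr (ler_sqrt _ (ltW s0)) lerDl mulr_ge0// addr_ge0 ?sqr_ge0.
  by rewrite ler_norml => /andP[]; lra.
move: Nb; rewrite le_eqVlt => /orP[/eqP Nb|Nb].
  have b0E : b0 = - N by lra.
  have : b1 ^+ 2 + b2 ^+ 2 == 0.
    by move: N2; rewrite b0E sqrrN => h; apply/eqP; lra.
  rewrite paddr_eq0 ?sqr_ge0// !sqrf_eq0 => /andP[/eqP -> /eqP ->].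
  exists 0, (Complex (Num.sqrt N) 0); split.
  - by apply/orP; right; rewrite eq_complex /= eqxx andbT sqrtr_eq0 -ltNge.
  - apply: complex_ext; rewrite !ReImE /=; last by ring.
    by rewrite b0E -{3}(sqr_sqrtr (ltW N0)); ring.
  - by rewrite rmorph0 mul0r.
set a : R := Num.sqrt ((N + b0) / 2).
have a0 : 0 < a by rewrite sqrtr_gt0 divr_gt0.
have a2 : a ^+ 2 = (N + b0) / 2 by rewrite sqr_sqrtr// ltW// divr_gt0.
have an0 : a != 0 by rewrite gt_eqF.
exists (Complex a 0), (Complex (b1 / a) (b2 / a)); split.
- by rewrite eq_complex /= (gt_eqF a0).
- apply: complex_ext; rewrite !ReImE /=; last by ring.
  have -> : b0 = a ^+ 2 - (b1 ^+ 2 + b2 ^+ 2) / a ^+ 2.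
    have -> : b1 ^+ 2 + b2 ^+ 2 = (N - b0) * (N + b0) / 4.
      by rewrite -subr_sqr; lra.
    rewrite a2; have h : N + b0 != 0 by rewrite gt_eqF.
    by field; rewrite h.
  by field.
- by apply: complex_ext; rewrite !ReImE /=; field.
Qed.

(* On the span of [x] and [y] both forms are linear in the Hopf coordinates of
   the coefficients, since their values at [x] and [y] are opposite. *)
Lemma isotropic_vector n (G H : 'M[C]_n) (x y : 'cV[C]_n) :
  x != 0 -> y != 0 -> qform G x = - qform G y -> Re (qform H x) = - Re (qform H y) ->
  exists z : 'cV[C]_n, [/\ z != 0, qform G z = 0 & 0 <= Re (qform H z)].
Proof.
move=> x0 y0 Gxy Hxy.
(* The left side of this relation is the value of [G] at a combination with Hopf coordinates [b0]
   and [b1 + i b2], so any preimage under the Hopf map makes [G] vanish. *)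
have [b0 [b1 [b2 [bn0 bE]]]] := real_relation3 (qform G x)
  (sform G x y + sform G y x) ('i%C * (sform G x y - sform G y x)).
(* The relation may be negated, which flips the sign of the corresponding value of [H]. *)
wlog Hb : b0 b1 b2 bn0 bE / 0 <= Re (Complex b0 0 * qform H x
    + Complex b1 b2 * sform H x y + Complex b1 (- b2) * sform H y x).
  move=> wl.
  have [h0|h0] := leP 0 (Re (Complex b0 0 * qform H x
    + Complex b1 b2 * sform H x y + Complex b1 (- b2) * sform H y x)).
    exact: wl bn0 bE h0.
  apply: (wl (- b0) (- b1) (- b2)); rewrite ?oppr_eq0//.
    rewrite -[RHS]oppr0 -bE; move: (qform G x) (sform G x y) (sform G y x) => p q u.
    by apply: complex_ext; rewrite !ReImE /=; ring.
  move: h0; rewrite -oppr_gt0 => /ltW /le_trans; apply.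
  move: (qform H x) (sform H x y) (sform H y x) => p q u.
  by rewrite !ReImE /=; lra.
have [a [b [abn0 ab0 ab]]] := hopf_surjective bn0.
have ba : Num.conj b * a = Complex b1 (- b2).
  by rewrite -{1}[a]conjCK -rmorphM mulrC ab.
pose z := a *: x + b *: y.
have Gz : qform G z = 0.
  have Gy : qform G y = - qform G x by rewrite Gxy opprK.
  rewrite qform_comb Gy.
  rewrite mulrN -mulrBl ab0 ab ba -[RHS]bE.
  move: (qform G x) (sform G x y) (sform G y x) => p q u.
  apply: complex_ext; rewrite !ReImE /=; ring.
have Hz : 0 <= Re (qform H z).
  rewrite (le_trans Hb)// qform_comb ab ba.
  (* Splitting |a|^2 as |b|^2 + b0 leaves |b|^2 times the sum of the values of [H] at [x] and [y],
     whose real part vanishes. *)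
  have -> : Num.conj a * a = Num.conj b * b + Complex b0 0 by rewrite -ab0 subrKC.
  have -> : Num.conj b * b = Complex (Re (Num.conj b * b)) 0.
    by apply: complex_ext; rewrite // !ReImE /=; ring.
  set c := Re (Num.conj b * b).
  have : Re (Complex c 0 * qform H x) + Re (Complex c 0 * qform H y) = 0.
    by rewrite !ReM /= Hxy; ring.
  move: (qform H x) (qform H y) (sform H x y) (sform H y x) => p q u v.
  by rewrite !ReImE /= => h; lra.
(* If the combination is zero, [y] is a multiple of [x]. Opposite values at [x] and [y] then force
   [G] and the real part of [H] to vanish at [x], and [x] itself serves. *)
have [z0|z0] := eqVneq z 0; last by exists z.
have b_n0 : b != 0.
  apply: contraTneq isT => b00; move: z0 abn0; rewrite /z b00 scale0r addr0 eqxx orbF.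
  by move/eqP; rewrite scaler_eq0 (negPf x0) orbF => ->.
have yE : y = (- a / b) *: x.
  move/eqP: z0; rewrite /z addr_eq0 => /eqP ax.
  by rewrite mulrC -scalerA scaleNr ax opprK scalerA mulVf// scale1r.
have cE c : exists2 k : R, 0 <= k & Num.conj c * c = Complex k 0.
  exists (Re c ^+ 2 + Im c ^+ 2); first by rewrite addr_ge0 ?sqr_ge0.
  by apply: complex_ext; rewrite !ReImE /=; ring.
have [k k0 kE] := cE (- a / b).
have k10 : 1 + k != 0 by rewrite gt_eqF// ltr_wpDr.
exists x; split => //.
- move: Gxy; rewrite yE qformZ kE => /eqP; rewrite -subr_eq0 opprK.
  have -> : qform G x + Complex k 0 * qform G x = Complex (1 + k) 0 * qform G x.
    by move: (qform G x) => p; apply: complex_ext; rewrite !ReImE /=; ring.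
  by rewrite mulf_eq0 eq_complex /= (negPf k10) => /eqP.
- move: Hxy; rewrite yE qformZ kE ReM /= mul0r subr0 => /eqP.
  rewrite -subr_eq0 opprK -[X in X + _]mul1r -mulrDl mulf_eq0 (negPf k10) => /eqP ->.
  by [].
Qed.

Lemma normalize_vector n (x : 'cV[C]_n) : x != 0 ->
  exists2 k : R, 0 < k & sqnorm (Complex k 0 *: x) = 1.
Proof.
move=> x0; have s0 : 0 < sqnorm x by rewrite sqnorm_gt0.
exists (Num.sqrt (sqnorm x))^-1; first by rewrite invr_gt0 sqrtr_gt0.
by rewrite sqnormZ /= expr0n addr0 exprVn sqr_sqrtr ?ltW// mulVf// gt_eqF.
Qed.

Lemma sqnorm_neq0 n (x : 'cV[C]_n) : sqnorm x = 1 -> x != 0.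
Proof. by move=> x1; rewrite -sqnorm_gt0 x1. Qed.

Lemma WgeP n (r : R) (A : 'M[C]_n) pq : 0 <= r -> Wge r A pq <->
  exists x : 'cV[C]_n, [/\ sqnorm x = 1, qform A x = Complex pq.1 pq.2 &
    r ^+ 2 <= sqnorm (A *m x)].
Proof.
move=> r0; split=> [[x [h [x1 p q hE rh]]]|[x [x1 qE rh]]].
  exists x; split => //; first exact: complex_ext.
  by rewrite -hE ler_pXn2r// nnegrE (le_trans r0).
exists x, (Num.sqrt (sqnorm (A *m x))); rewrite qE; split => //.
  by rewrite sqr_sqrtr ?sqnorm_ge0.
by rewrite -(ger0_norm r0) -sqrtr_sqr ler_sqrt ?sqnorm_ge0.
Qed.

(** Scaling [x] and [y] by the square roots of t and 1 - t makes the forms of A - c I and A^*A - h I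
    take opposite values, where c and h are the convex combinations of the values at [x] and [y].
    The vector from [isotropic_vector], once normalized, satisfies x^*Ax = c and |Ax|^2 >= h >=
    r^2. *)
Lemma Wge_convex n (r : R) (A : 'M[C]_n) pq1 pq2 (t : R) : 0 <= r -> 0 < t < 1 ->
  Wge r A pq1 -> Wge r A pq2 ->
  Wge r A (t * pq1.1 + (1 - t) * pq2.1, t * pq1.2 + (1 - t) * pq2.2).
Proof.
move=> r0 /andP[t0 t1] /(WgeP _ _ r0)[x [x1 qx hx]] /(WgeP _ _ r0)[y [y1 qy hy]].
have t1' : 0 < 1 - t by rewrite subr_gt0.
pose c := Complex (t * pq1.1 + (1 - t) * pq2.1) (t * pq1.2 + (1 - t) * pq2.2).
pose h := t * sqnorm (A *m x) + (1 - t) * sqnorm (A *m y).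
pose G := A - c *: 1%:M.
pose H := adjmx A *m A - Complex h 0 *: 1%:M.
have GE v : qform G v = qform A v - c * Complex (sqnorm v) 0.
  by rewrite qformD qformN qformZl qform1_sqnorm.
have HE v : Re (qform H v) = sqnorm (A *m v) - h * sqnorm v.
  by rewrite qformD qformN qformZl qform1_sqnorm qform_gram !ReImE /=; ring.
have sq (s : R) : 0 < s -> Num.conj (Complex (Num.sqrt s) 0) * Complex (Num.sqrt s) 0
    = Complex s 0.
  move=> s0; apply: complex_ext; rewrite !ReImE /=; last by ring.
  by rewrite -{3}(sqr_sqrtr (ltW s0)); ring.
have sn0 (s : R) : 0 < s -> Complex (Num.sqrt s) 0 != 0.
  by move=> s0; rewrite eq_complex /= eqxx andbT sqrtr_eq0 -ltNge.
have [] := @isotropic_vector n G H (Complex (Num.sqrt t) 0 *: x)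
    (Complex (Num.sqrt (1 - t)) 0 *: y).
- by rewrite scaler_eq0 (negPf (sn0 _ t0)) sqnorm_neq0.
- by rewrite scaler_eq0 (negPf (sn0 _ t1')) sqnorm_neq0.
- rewrite !qformZ !sq// !GE qx qy x1 y1.
  by apply: complex_ext; rewrite !ReImE /=; ring.
- rewrite !qformZ !sq// !ReM !HE x1 y1 /= /h; ring.
move=> z [z0 Gz Hz].
have [k k0 kz] := normalize_vector z0.
apply/(WgeP _ _ r0); exists (Complex k 0 *: z); split => //.
  have := congr1 ( *%R (Num.conj (Complex k 0) * Complex k 0)) Gz.
  rewrite -qformZ GE kz mulr0 mulr1 => /eqP; rewrite subr_eq0 => /eqP ->.
  by [].
have : 0 <= Re (qform H (Complex k 0 *: z)).
  rewrite qformZ ReM !ReImE /=; have := mulr_ge0 (sqr_ge0 k) Hz; lra.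
rewrite HE kz mulr1 subr_ge0; apply: le_trans.
rewrite (_ : r ^+ 2 = t * r ^+ 2 + (1 - t) * r ^+ 2); last by ring.
by rewrite lerD// ler_wpM2l// ltW.
Qed.
End Forms.

(** * Compactness of [Wge] *)

Section Compactness.
Local Open Scope classical_set_scope.
Variable R : realType.
Local Notation C := R[i].

(** Continuity is split into real and imaginary parts, so that only real-valued functions are
    handled. *)
Definition ccontinuous m (f : 'rV[R]_m -> C) : Prop :=
  continuous (fun u => Re (f u)) /\ continuous (fun u => Im (f u)).

Lemma ccontinuous_cst m (c : C) : ccontinuous (fun _ : 'rV[R]_m => c).
Proof. by split; exact: cst_continuous. Qed.

Lemma ccontinuousD m (f g : 'rV[R]_m -> C) :
  ccontinuous f -> ccontinuous g -> ccontinuous (fun u => f u + g u).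
Proof.
move=> [f1 f2] [g1 g2]; split => u.
- under eq_fun do rewrite ReD; apply: continuousD; [exact: f1|exact: g1].
- under eq_fun do rewrite ImD; apply: continuousD; [exact: f2|exact: g2].
Qed.

Lemma ccontinuousM m (f g : 'rV[R]_m -> C) :
  ccontinuous f -> ccontinuous g -> ccontinuous (fun u => f u * g u).
Proof.
move=> [f1 f2] [g1 g2]; split => u.
- under eq_fun do rewrite ReM.
  apply: (@continuousB _ _ _ (fun u => Re (f u) * Re (g u)) (fun u => Im (f u) * Im (g u)));
    by apply: continuousM; (apply: f1 || apply: g1 || apply: f2 || apply: g2).
- under eq_fun do rewrite ImM.
  apply: (@continuousD _ _ _ (fun u => Re (f u) * Im (g u)) (fun u => Im (f u) * Re (g u)));
    by apply: continuousM; (apply: f1 || apply: g1 || apply: f2 || apply: g2).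
Qed.

Lemma ccontinuous_conj m (f : 'rV[R]_m -> C) :
  ccontinuous f -> ccontinuous (fun u => Num.conj (f u)).
Proof.
move=> [f1 f2]; split => u; under eq_fun do rewrite conjCE /=; first exact: f1.
by apply: continuousN; exact: f2.
Qed.

Lemma ccontinuous_sum m I (r : seq I) (f : I -> 'rV[R]_m -> C) :
  (forall i, ccontinuous (f i)) -> ccontinuous (fun u => \sum_(i <- r) f i u).
Proof.
move=> fc; elim: r => [|i r IHr].
  by under eq_fun do rewrite big_nil; exact: ccontinuous_cst.
by under eq_fun do rewrite big_cons; exact: ccontinuousD.
Qed.

(** Real coordinates on the complex vectors, through which closed bounded sets of real row vectors
    give compactness. *)
Definition cvec n (u : 'rV[R]_(n + n)) : 'cV[C]_n :=
  \col_i Complex (u 0 (lshift n i)) (u 0 (rshift n i)).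

Lemma cvec_surj n (x : 'cV[C]_n) : exists u, cvec u = x.
Proof.
exists (row_mx (\row_i Re (x i 0)) (\row_i Im (x i 0))).
apply/matrixP => i j; rewrite ord1 mxE row_mxEl row_mxEr !mxE.
by case: (x i 0).
Qed.

Lemma cvec_continuous n i : ccontinuous (fun u : 'rV[R]_(n + n) => cvec u i 0).
Proof.
split => u; under eq_fun do rewrite mxE /=; exact: coord_continuous.
Qed.

Lemma qform_continuous n (A : 'M[C]_n) :
  ccontinuous (fun u : 'rV[R]_(n + n) => qform A (cvec u)).
Proof.
rewrite /qform; under eq_fun do rewrite mxE.
apply: ccontinuous_sum => i; apply: ccontinuousM; last exact: cvec_continuous.
under eq_fun do rewrite mxE.
apply: ccontinuous_sum => j; apply: ccontinuousM; last exact: ccontinuous_cst.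
under eq_fun do rewrite adjmxE.
exact/ccontinuous_conj/cvec_continuous.
Qed.

Lemma sqnorm_cvec_continuous n (A : 'M[C]_n) :
  continuous (fun u : 'rV[R]_(n + n) => sqnorm (A *m cvec u)).
Proof.
have [h _] := qform_continuous (adjmx A *m A).
by under eq_fun do rewrite -[sqnorm _]/(Re (Complex (sqnorm _) 0)) -qform_gram.
Qed.

Lemma sphere_cap_compact n (r : R) (A : 'M[C]_n) : compact
  [set u : 'rV[R]_(n + n) | sqnorm (cvec u) = 1 /\ r ^+ 2 <= sqnorm (A *m cvec u)].
Proof.
apply: bounded_closed_compact.
  (* The square of each real coordinate is one of the summands of [sqnorm], so every coordinate is
     at most 1 in absolute value. *)
  exists 1; split; first exact: num_real.
  move=> M M1 u /= [u1 _]; rewrite /= [leLHS]/Num.norm /= mx_normrE.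
  apply/bigmax_leP; split => [|[i j] _ /=]; first by rewrite ltW// (lt_trans _ M1).
  rewrite (le_trans _ (ltW M1))// ord1 -(@ler_pXn2r _ 2)// ?nnegrE// expr1n.
  rewrite -normrX ger0_norm ?sqr_ge0// -u1 sqnorm_sum.
  case: (split_ordP j) => k ->; rewrite (bigD1 k)//= mxE /=.
  - rewrite -addrA lerDl addr_ge0 ?sqr_ge0// sumr_ge0// => l _.
    by rewrite addr_ge0 ?sqr_ge0.
  - rewrite addrAC lerDr addr_ge0 ?sqr_ge0// sumr_ge0// => l _.
    by rewrite addr_ge0 ?sqr_ge0.
have c1 : continuous (fun u : 'rV[R]_(n + n) => sqnorm (cvec u)).
  by have := @sqnorm_cvec_continuous n 1%:M; under eq_fun do rewrite mul1mx.
apply: closedI.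
- by apply: (preimage_closed _ (@closed_eq R 1)) => u _; exact: c1.
- apply: (preimage_closed _ (@closed_ge R (r ^+ 2))) => u _.
  exact: sqnorm_cvec_continuous.
Qed.

Lemma Wge_compact n (r : R) (A : 'M[C]_n) : 0 <= r -> compact (Wge r A).
Proof.
move=> r0; have [c1 c2] := qform_continuous A.
pose f (u : 'rV[R]_(n + n)) := (Re (qform A (cvec u)), Im (qform A (cvec u))).
rewrite (_ : Wge r A = f @` [set u : 'rV[R]_(n + n) |
  sqnorm (cvec u) = 1 /\ r ^+ 2 <= sqnorm (A *m cvec u)]); last first.
  apply/seteqP; split => [pq /(WgeP _ _ r0)[x [x1 qx hx]]|_ [u [u1 hu] <-]].
    have [u ux] := cvec_surj x; exists u; first by rewrite /= ux.
    by rewrite /f ux qx; case: (pq).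
  by apply/(WgeP _ _ r0); exists (cvec u); split; rewrite /f //=; case: (qform A _).
apply: continuous_compact; last exact: sphere_cap_compact.
apply: continuous_subspaceT => u.
by apply: (@cvg_pair _ _ _ _ (nbhs (Re (qform A (cvec u)))) (nbhs (Im (qform A (cvec u)))));
  (exact: nbhs_filter || exact: c1 || exact: c2).
Qed.
End Compactness.

(** * A half-plane containing [Wge], and existence of the extreme angles *)

Section Angles.
Local Open Scope classical_set_scope.
Variable R : realType.
Local Notation C := R[i].
Implicit Types (t th : R).

Lemma unit_circle_angle (p q : R) : p ^+ 2 + q ^+ 2 = 1 ->
  exists th, [/\ - pi <= th <= pi, p = cos th & q = sin th].
Proof.
move=> pq1; have p1 : -1 <= p <= 1.
  by rewrite -ler_norml -(@ler_pXn2r _ 2)// ?nnegrE// expr1n -normrX ger0_norm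
    ?sqr_ge0// -pq1 lerDl sqr_ge0.
have cE : cos (acos p) = p by rewrite acosK// in_itv.
have sE : sin (acos p) = `|q|.
  by rewrite sin_acos// -sqrtr_sqr; congr Num.sqrt; rewrite -pq1 addrAC subrr add0r.
have a0 := acos_ge0 p1; have api := acos_lepi p1; have pi0 := @pi_ge0 R.
have [q0|q0] := leP 0 q.
  by exists (acos p); rewrite cE sE ger0_norm//; split => //; apply/andP; split; lra.
exists (- acos p); rewrite cosN sinN cE sE ltr0_norm// opprK; split => //.
by apply/andP; split; lra.
Qed.

(** One turn at most is needed in this range. The range fits the midpoint of two angles, each within
    pi/2 of a direction in [- pi, pi], which has to be moved to the principal branch. *)
Lemma principal_shift (m : R) : - (3 * pi / 2) < m < 3 * pi / 2 ->
  exists k, [/\ forall t, cos (t + k) = cos t, forall t, sin (t + k) = sin t &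
    - pi < m + k <= pi].
Proof.
have pi0 := @pi_gt0 R; move=> /andP[m1 m2].
have [h|h] := leP m (- pi).
  exists (pi *+ 2); split => [t|t|]; [exact: cosD2pi|exact: sinD2pi|].
  by rewrite mulr2n; apply/andP; split; lra.
have [h'|h'] := leP m pi.
  by exists 0; split => [t|t|]; rewrite addr0// h h'.
exists (- (pi *+ 2)); split => [t|t|].
- by rewrite -[LHS]cosD2pi subrK.
- by rewrite -[LHS]sinD2pi subrK.
- by rewrite mulr2n; apply/andP; split; lra.
Qed.

Lemma atan_polar (a b : R) : 0 < a -> exists rho, [/\ 0 < rho,
  a = rho * cos (atan (b / a)) & b = rho * sin (atan (b / a))].
Proof.
move=> a0; set k := atan _.
have ck : 0 < cos k by rewrite cos_gt0_pihalf// atan_gtNpi2 atan_ltpi2.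
exists (a / cos k); split; first by rewrite divr_gt0.
- by rewrite divfK// gt_eqF.
- have := atanK (b / a); rewrite -/k /tan => /(congr1 ( *%R a)).
  rewrite [a * (b / a)]mulrC divfK ?gt_eqF// => <-.
  by rewrite mulrA mulrAC.
Qed.

(** After rotation by [- th] the point has positive first coordinate, so [atan] of the slope is its
    angle. *)
Lemma angle_of_rotated (th : R) (pq : R * R) :
  0 < cos th * pq.1 + sin th * pq.2 ->
  angle_of pq (th + atan ((cos th * pq.2 - sin th * pq.1)
                          / (cos th * pq.1 + sin th * pq.2))).
Proof.
move=> /(atan_polar (cos th * pq.2 - sin th * pq.1))[rho [rho0]].
set k := atan _ => aE bE; exists rho; split => //.
- rewrite cosD mulrBr mulrCA -aE [rho * (sin th * _)]mulrCA -bE.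
  transitivity ((cos th ^+ 2 + sin th ^+ 2) * pq.1); last by ring.
  by rewrite cos2Dsin2 mul1r.
- rewrite sinD mulrDr mulrCA -aE [rho * (cos th * _)]mulrCA -bE.
  transitivity ((cos th ^+ 2 + sin th ^+ 2) * pq.2); last by ring.
  by rewrite cos2Dsin2 mul1r.
Qed.

(** By compactness there is a point nearest to the origin, nonzero by [r_sectorial]. By convexity
    its direction has positive inner product with every point of the set. *)
Lemma Wge_half_plane n (r : R) (A : 'M[C]_n) :
  0 <= r -> Wge r A !=set0 -> r_sectorial r A ->
  exists2 th : R, - pi <= th <= pi &
    forall pq, Wge r A pq -> 0 < cos th * pq.1 + sin th * pq.2.
Proof.
move=> r0 W0 Ar.
have cf : continuous (fun pq : R * R => pq.1 ^+ 2 + pq.2 ^+ 2).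
  move=> pq; apply: cvgD; apply: cvgM; by [exact: cvg_fst|exact: cvg_snd].
have [[p q] /set_mem Wpq pqmin] := compact_EVT_min W0 (Wge_compact (A := A) r0)
  (continuous_subspaceT (A := Wge r A) cf).
have s0 : 0 < p ^+ 2 + q ^+ 2.
  rewrite lt_def addr_ge0 ?sqr_ge0// andbT paddr_eq0 ?sqr_ge0// !sqrf_eq0.
  by apply/negP => /andP[/eqP p0 /eqP q0]; apply: Ar; move: Wpq; rewrite p0 q0.
pose N : R := Num.sqrt (p ^+ 2 + q ^+ 2).
have N0 : 0 < N by rewrite sqrtr_gt0.
have N2 : N ^+ 2 = p ^+ 2 + q ^+ 2 by rewrite sqr_sqrtr// ltW.
have [|th [thpi pE qE]] := @unit_circle_angle (p / N) (q / N).
  by rewrite !exprMn exprVn -mulrDl -N2 mulfV// expf_eq0 gt_eqF.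
exists th => // -[p' q'] W' /=; rewrite -pE -qE.
suff : 0 < p * p' + q * q'.
  move=> h; rewrite [p / N * _]mulrAC [q / N * _]mulrAC -mulrDl divr_gt0//.
(* First variation of the distance along the segment from the nearest point. *)
rewrite (lt_le_trans s0)// leNgt; apply/negP => h.
pose d := p ^+ 2 + q ^+ 2 - (p * p' + q * q').
have d0 : 0 < d by rewrite subr_gt0.
pose e := (p' - p) ^+ 2 + (q' - q) ^+ 2.
have e0 : 0 <= e by rewrite addr_ge0 ?sqr_ge0.
(* The squared distance drops by t (2 d - t e), which is positive once t e < d; the denominator also
   ensures t < 1. *)
pose t := d / (d + e + 1).
have D0 : 0 < d + e + 1 by lra.
have t0 : 0 < t by rewrite divr_gt0.
have t1 : t < 1 by rewrite ltr_pdivrMr//; lra.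
have te : t * e < d.
  by rewrite mulrAC ltr_pdivrMr// ltr_pM2l//; lra.
have t01 : 0 < t < 1 by rewrite t0 t1.
have := pqmin _ (mem_set (Wge_convex r0 t01 W' Wpq)); rewrite /=.
apply/negP; rewrite -ltNge.
have -> : (t * p' + (1 - t) * p) ^+ 2 + (t * q' + (1 - t) * q) ^+ 2
    = p ^+ 2 + q ^+ 2 - t * (2 * d - t * e).
  by rewrite /d /e; ring.
by rewrite ltrBlDr ltrDl mulr_gt0//; lra.
Qed.

(** Relative to the half-plane direction [th], angles are [atan] of the continuous slope [f], which
    attains its extrema on the compact set. As [atan] is increasing with values in (- pi/2, pi/2),
    the extreme angles differ by less than pi. *)
Lemma psi_bounds_exist n (r : R) (A : 'M[C]_n) :
  0 <= r -> Wge r A !=set0 -> r_sectorial r A ->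
  exists lo hi, psi_bounds r A lo hi.
Proof.
move=> r0 W0 Ar; have [th /andP[th1 th2] Wth] := Wge_half_plane r0 W0 Ar.
pose f (pq : R * R) := (cos th * pq.2 - sin th * pq.1) / (cos th * pq.1 + sin th * pq.2).
have cf : {within Wge r A, continuous f}.
  apply: continuous_in_subspaceT => pq /set_mem Wpq.
  have lin (a b : R) : {for pq, continuous (fun pq : R * R => a * pq.1 + b * pq.2)}.
    apply: cvgD; apply: cvgM; try exact: cvg_cst.
      exact: cvg_fst.
    exact: cvg_snd.
  apply: (@continuousM _ _ (fun pq : R * R => cos th * pq.2 - sin th * pq.1)
    (fun pq : R * R => (cos th * pq.1 + sin th * pq.2)^-1)); last first.
    by apply: cvgV; [rewrite gt_eqF// Wth|exact: lin].
  have := lin (- sin th) (cos th); congr (continuous_at _ _).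
  by apply/funext => x; rewrite addrC mulNr.
have [lo /set_mem Wlo minf] := compact_EVT_min W0 (Wge_compact (A := A) r0) cf.
have [hi /set_mem Whi maxf] := compact_EVT_max W0 (Wge_compact (A := A) r0) cf.
have fle : atan (f lo) <= atan (f hi) by rewrite le_atan// minf// mem_set.
have := atan_gtNpi2 (f lo); have := atan_ltpi2 (f hi).
have := atan_gtNpi2 (f hi); have := atan_ltpi2 (f lo) => lo2 hi1 hi2 lo1.
have [|k [ck sk /andP[k1 k2]]] :=
    @principal_shift ((th + atan (f lo) + (th + atan (f hi))) / 2).
  by apply/andP; split; lra.
have ang pq : Wge r A pq -> angle_of pq (th + atan (f pq) + k).
  move=> /Wth /angle_of_rotated[rho [? ? ?]].
  by exists rho; rewrite ck sk.
exists (th + atan (f lo) + k), (th + atan (f hi) + k); split.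
- move=> pq Wpq; exists (th + atan (f pq) + k); last exact: ang.
  by rewrite !lerD2r !lerD2l !le_atan ?minf ?maxf ?mem_set.
- by exists lo => //; exact: ang.
- by exists hi => //; exact: ang.
- by apply/andP; split; lra.
- by apply/andP; split; lra.
Qed.
End Angles.

(** * Spectral decomposition and the largest singular value *)

Section Spectral.
Local Open Scope classical_set_scope.
Variable R : realType.
Local Notation C := R[i].
Implicit Types n : nat.

Definition rdiag n (d : 'I_n -> R) : 'M[C]_n := diag_mx (\row_k Complex (d k) 0).

Lemma adjmx_rdiag n (d : 'I_n -> R) : adjmx (rdiag d) = rdiag d.
Proof.
apply/matrixP => i j; rewrite adjmxE !mxE eq_sym.
by case: eqP => [->|_]; rewrite ?mulr1n ?mulr0n ?rmorph0// conjCE /= oppr0.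
Qed.

Lemma rdiag_mul_diag n (d : 'I_n -> R) (e : 'I_n -> C) :
  rdiag d *m diag_mx (\row_k e k) = diag_mx (\row_k (Complex (d k) 0 * e k)).
Proof.
rewrite mulmx_diag; congr diag_mx.
by apply/rowP => k; rewrite !mxE.
Qed.

Lemma Re_qform_rdiag n (d : 'I_n -> R) x :
  Re (qform (rdiag d) x) = \sum_k d k * (Re (x k 0) ^+ 2 + Im (x k 0) ^+ 2).
Proof.
rewrite qform_diag Re_sum; apply: eq_bigr => k _.
by rewrite mxE !ReImE /=; ring.
Qed.

Lemma sqnorm_unitary n (P : 'M[C]_n) x : adjmx P *m P = 1%:M -> sqnorm (P *m x) = sqnorm x.
Proof.
move=> PP; have := qform_gram P x; rewrite PP qform1_sqnorm.
by move=> /(congr1 (@complex.Re R)) /= ->.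
Qed.

(** The spectral theorem for normal matrices, expressed with [adjmx] and with the eigenvalues as
    real numbers. *)
Lemma hermitian_spectral n (H : 'M[C]_n) : adjmx H = H ->
  exists (P : 'M[C]_n) (d : 'I_n -> R),
    [/\ P *m adjmx P = 1%:M, adjmx P *m P = 1%:M & H = adjmx P *m rdiag d *m P].
Proof.
move=> HH; have adjE m (M : 'M[C]_m) : map_mx Num.conj M^T = adjmx M.
  by rewrite /adjmx map_trmx.
have Hherm : H \is hermsymmx.
  by apply/is_hermitianmxP; rewrite expr0 scale1r adjE HH.
have /orthomx_spectralP HE := hermitian_normalmx Hherm.
have uP := spectral_unitarymx H; have rd := hermitian_spectral_diag_real Hherm.
have PP : spectralmx H *m adjmx (spectralmx H) = 1%:M.
  by move/unitarymxP: uP; rewrite adjE.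
exists (spectralmx H), (fun k => Re (spectral_diag H 0 k)); split => //.
  exact: mulmx1C.
rewrite {1}HE (invmx_unitary uP) adjE; congr (_ *m _ *m _).
congr diag_mx; apply/rowP => k; rewrite mxE.
have /complex_realP[a ->] : spectral_diag H 0 k \is Num.real by exact: mxOverP.
by [].
Qed.

Lemma gram_spectral n (B : 'M[C]_n) : exists (P : 'M[C]_n) (d : 'I_n -> R),
  [/\ P *m adjmx P = 1%:M, adjmx P *m P = 1%:M &
      adjmx B *m B = adjmx P *m rdiag d *m P].
Proof. by apply: hermitian_spectral; rewrite adjmxM adjmxK. Qed.

(** [eigenvalue] refers to row vectors: right multiplication by [adjmx P] carries eigenvectors to
    those of the diagonal matrix, and row k of [P] is an eigenvector for [d k]. *)
Lemma eigenvalue_rdiag n (P : 'M[C]_n) (d : 'I_n -> R) (a : C) :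
  P *m adjmx P = 1%:M -> adjmx P *m P = 1%:M ->
  eigenvalue (adjmx P *m rdiag d *m P) a <-> exists k, a = Complex (d k) 0.
Proof.
move=> PP PP'; split=> [/eigenvalueP[v vM v0]|[k ->]].
  pose w := v *m adjmx P.
  have w0 : w != 0.
    apply: contraNneq v0 => w0.
    by rewrite -[v]mulmx1 -PP' mulmxA -/w w0 mul0mx.
  have wE : w *m rdiag d = a *: w.
    rewrite /w scalemxAl -vM !mulmxA -[X in _ = X]mulmxA PP mulmx1 //.
  have [k wk] : exists k, w 0 k != 0 by apply/rV0Pn.
  clearbody w; exists k; have /rowP/(_ k) := wE.
  by rewrite mul_mx_diag !mxE mulrC => /(mulIf wk) ->.
apply/eigenvalueP; exists (row k P); last first.
  apply: contraTneq isT => k0.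
  have : (row k P *m adjmx P) 0 k = 1.
    by rewrite -row_mul PP !mxE eqxx.
  by rewrite k0 mul0mx mxE => /eqP; rewrite eq_sym oner_eq0.
rewrite -!row_mul !mulmxA PP mul1mx mul_diag_mx.
by apply/rowP => j; rewrite !mxE.
Qed.

Lemma gram_spectrum_ge0 n (B P : 'M[C]_n) (d : 'I_n -> R) k :
  P *m adjmx P = 1%:M -> adjmx B *m B = adjmx P *m rdiag d *m P -> 0 <= d k.
Proof.
move=> PP BE; pose e : 'cV[C]_n := delta_mx k 0.
have : Re (qform (adjmx B *m B) (adjmx P *m e)) = d k.
  rewrite BE qform_mulmx mulmxA PP mul1mx Re_qform_rdiag (bigD1 k)//= big1.
    by rewrite !mxE !eqxx /=; ring.
  by move=> j /negPf jk; rewrite !mxE jk /=; ring.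
by move=> <-; rewrite qform_gram /= sqnorm_ge0.
Qed.

(** In the spectral basis of B^*B, |Bx|^2 is a sum of squared coordinates weighted by eigenvalues,
    each at most the square of [sigma_max B]. *)
Lemma sigma_max_spec n (B : 'M[C]_n) : (0 < n)%N ->
  0 <= sigma_max B /\
  forall x, sqnorm (B *m x) <= sigma_max B ^+ 2 * sqnorm x.
Proof.
case: n B => // n B _.
have [P [d [PP PP' BE]]] := gram_spectral B.
have d0 k := gram_spectrum_ge0 k PP BE.
rewrite /sigma_max; case: xgetP => [s _ [s0 _ smax]|noex].
  split => // x; have := qform_gram B x => /(congr1 (@complex.Re R)) /= <-.
  rewrite BE qform_mulmx Re_qform_rdiag -(sqnorm_unitary x PP') sqnorm_sum mulr_sumr.
  apply: ler_sum => k _; apply: ler_wpM2r; first by rewrite addr_ge0 ?sqr_ge0.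
  have := smax (Complex (d k) 0); rewrite BE lecR; apply.
  by apply/(eigenvalue_rdiag _ _ PP PP'); exists k.
(* The default of [xget] cannot occur: the square root of the largest diagonal entry is
   admissible. *)
exfalso; have [k _ kmax] := @arg_maxP _ _ _ ord0 xpredT d isT.
apply: (noex (Num.sqrt (d k))); rewrite /= sqr_sqrtr//; split.
- exact: sqrtr_ge0.
- by rewrite BE; apply/(eigenvalue_rdiag _ _ PP PP'); exists k.
- by move=> a; rewrite BE => /(eigenvalue_rdiag _ _ PP PP')[j ->]; rewrite lecR; exact: kmax.
Qed.

(** * Congruences and existence of the phases *)

Lemma posdef_gram n (H : 'M[C]_n) : adjmx H = H ->
  (forall x, x != 0 -> 0 < Re (qform H x)) ->
  exists2 S : 'M[C]_n, S \in unitmx & H = adjmx S *m S.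
Proof.
move=> HH Hpos; have [P [d [PP PP' HE]]] := hermitian_spectral HH.
have d0 k : 0 < d k.
  pose e : 'cV[C]_n := delta_mx k 0.
  have -> : d k = Re (qform H (adjmx P *m e)).
    rewrite HE qform_mulmx mulmxA PP mul1mx Re_qform_rdiag (bigD1 k)//= big1.
      by rewrite !mxE !eqxx /=; ring.
    by move=> j /negPf jk; rewrite !mxE jk /=; ring.
  apply: Hpos; apply: contraTneq isT => e0.
  have /matrixP/(_ k 0) : e = 0 by rewrite -[e]mul1mx -PP -mulmxA e0 mulmx0.
  by rewrite !mxE !eqxx => /eqP; rewrite oner_eq0.
have SE : rdiag d = rdiag (fun k => Num.sqrt (d k)) *m rdiag (fun k => Num.sqrt (d k)).
  rewrite rdiag_mul_diag; congr diag_mx; apply/rowP => k; rewrite !mxE.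
  apply: complex_ext; rewrite !ReImE /=; last by ring.
  by rewrite -[LHS](sqr_sqrtr (ltW (d0 k))); ring.
exists (rdiag (fun k => Num.sqrt (d k)) *m P).
  have [uP _] := mulmx1_unit PP; rewrite unitmx_mul uP andbT unitmxE det_diag unitfE.
  apply/prodf_neq0 => k _; rewrite mxE eq_complex /= eqxx andbT.
  by rewrite sqrtr_eq0 -ltNge.
by rewrite adjmxM adjmx_rdiag HE SE !mulmxA.
Qed.

(* A congruence turns the Hermitian part of [c *: B] into the identity, and a further
   unitary one diagonalizes the skew part. *)
Lemma accretive_congruence n (B : 'M[C]_n) (c : C) :
  (forall x, x != 0 -> 0 < Re (c * qform B x)) ->
  exists (T : 'M[C]_n) (l : 'I_n -> R), T \in unitmx /\
    c *: B = adjmx T *m diag_mx (\row_k Complex 1 (l k)) *m T.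
Proof.
move=> cB; pose h : C := Complex (1 / 2) 0.
have hh : Num.conj h = h by rewrite conjCE /= oppr0.
pose D := c *: B.
(* [H] is the Hermitian part of [D]; [K] is also Hermitian, and [D] = H + i K. *)
pose H := h *: (D + adjmx D).
pose K := (- 'i%C * h) *: (D - adjmx D).
have ch : Num.conj (- 'i%C * h) = 'i%C * h.
  by apply: complex_ext; rewrite !ReImE /=; ring.
have HH : adjmx H = H by rewrite adjmxZ hh adjmxD adjmxK addrC.
have KK : adjmx K = K.
  by rewrite adjmxZ ch adjmxD adjmxN adjmxK /K mulNr scaleNr -scalerN opprB.
have DE : D = H + 'i%C *: K.
  have -> : 'i%C *: K = h *: (D - adjmx D).
    by rewrite /K scalerA mulrA mulrN -expr2 sqr_i opprK mul1r.
  rewrite -scalerDr.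
  rewrite addrACA subrr addr0 [RHS]scalerDr -[RHS](scalerDl D h h).
  have -> : h + h = 1 by apply: complex_ext => /=; lra.
  by rewrite scale1r.
have Hpos x : x != 0 -> 0 < Re (qform H x).
  move=> /cB; rewrite qformZl qformD qform_conj qformZl.
  by move: (c * qform B x) => w; rewrite !ReImE /=; lra.
have [S uS HE] := posdef_gram HH Hpos.
pose V := invmx S; have SV : S *m V = 1%:M by rewrite mulmxV.
have VS : V *m S = 1%:M by rewrite mulVmx.
have aVS : adjmx S *m adjmx V = 1%:M by rewrite -adjmxM VS adjmx1.
have [|Q [l [QQ QQ' KE]]] := @hermitian_spectral n (adjmx V *m K *m V).
  by rewrite !adjmxM adjmxK KK mulmxA.
exists (Q *m S), l; split.
  by have [uQ _] := mulmx1_unit QQ; rewrite unitmx_mul uQ.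
have {}KE : K = adjmx (Q *m S) *m rdiag l *m (Q *m S).
  transitivity (adjmx S *m (adjmx V *m K *m V) *m S).
    by rewrite !mulmxA aVS mul1mx -mulmxA VS mulmx1.
  by rewrite KE adjmxM !mulmxA.
have {}HE : H = adjmx (Q *m S) *m 1%:M *m (Q *m S).
  by rewrite mulmx1 adjmxM -mulmxA [adjmx Q *m _]mulmxA QQ' mul1mx.
rewrite -/D DE {1}HE {1}KE scalemxAl scalemxAr -mulmxDl -mulmxDr.
congr (_ *m _ *m _); apply/matrixP => i j; rewrite !mxE.
case: eqP => _; rewrite ?mulr1n ?mulr0n ?mulr0 ?addr0//.
by apply: complex_ext; rewrite !ReImE /=; ring.
Qed.

(** [Wge 0 B] is the numerical range, so it lies in an open half-plane and a rotation makes [B]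
    accretive. In the resulting congruence, each entry 1 + i l has phase [atan l], and its modulus
    is absorbed into the congruence. *)
Lemma phase_bounds_exist n (B : 'M[C]_n) : (0 < n)%N -> sectorial B ->
  exists pmax pmin, phase_bounds B pmax pmin.
Proof.
case: n B => // n B _ sB.
have W0 : Wge 0 B !=set0.
  have [|k k0 e1] := @normalize_vector R _ (delta_mx 0 0 : 'cV[C]_n.+1).
    apply/negP => /eqP/matrixP/(_ 0 0); rewrite !mxE => /eqP.
    by rewrite oner_eq0.
  set x := _ *: _ in e1; exists (Re (qform B x), Im (qform B x)).
  apply/WgeP => //; exists x; split => //; first by case: (qform B x).
  by rewrite expr0n sqnorm_ge0.
have rB : r_sectorial 0 B.
  move=> /WgeP[]// x [x1 qx _]; apply: sB; exists x; split => //.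
have [th /andP[th1 th2] Wth] := Wge_half_plane (lexx 0) W0 rB.
have [|T [l [uT BE]]] := @accretive_congruence _ B (expi (- th)).
  move=> x x0; have [k k0 kx] := normalize_vector x0.
  have /Wth /= : Wge 0 B (Re (qform B (Complex k 0 *: x)), Im (qform B (Complex k 0 *: x))).
    apply/WgeP => //; exists (Complex k 0 *: x); split => //.
      by case: (qform B _).
    by rewrite expr0n sqnorm_ge0.
  rewrite qformZ; move: (qform B x) => w; rewrite !ReImE /= cosN sinN => h.
  have k2 : 0 < k ^+ 2 by rewrite exprn_gt0.
  rewrite -(pmulr_rgt0 _ k2); move: h; congr (_ < _); ring.
pose mx := [arg max_(i > ord0) l i]%O; pose mn := [arg min_(i < ord0) l i]%O.
have lmx i : l i <= l mx by rewrite /mx; case: arg_maxP => // k _; apply.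
have lmn i : l mn <= l i by rewrite /mn; case: arg_minP => // k _; apply.
have := atan_gtNpi2 (l mn); have := atan_ltpi2 (l mn).
have := atan_gtNpi2 (l mx); have := atan_ltpi2 (l mx) => mx2 mx1 mn2 mn1.
have [|k [ck sk /andP[k1 k2]]] :=
    @principal_shift R ((th + atan (l mx) + (th + atan (l mn))) / 2).
  by apply/andP; split; lra.
exists (th + atan (l mx) + k), (th + atan (l mn) + k).
(* A fourth root, since [rho] enters twice, through the congruence and its adjoint; thus 1 + i l =
   rho^2 e^(i atan l). *)
pose rho i : R := Num.sqrt (Num.sqrt (1 + l i ^+ 2)).
have rho0 i : 0 < rho i by rewrite !sqrtr_gt0 ltr_wpDr ?sqr_ge0.
exists (rdiag rho *m T), (fun i => th + atan (l i) + k); split.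
- rewrite unitmx_mul uT andbT unitmxE det_diag unitfE.
  by apply/prodf_neq0 => i _; rewrite mxE eq_complex /= eqxx andbT gt_eqF.
- have -> : B = expi th *: (expi (- th) *: B).
    rewrite scalerA (_ : _ * _ = 1) ?scale1r//.
    apply: complex_ext; rewrite !ReImE /= cosN sinN; last by ring.
    by rewrite -(cos2Dsin2 th); ring.
  rewrite BE adjmxM adjmx_rdiag -!mulmxA scalemxAr; congr (_ *m _).
  rewrite !mulmxA scalemxAl; congr (_ *m _).
  rewrite rdiag_mul_diag mulmx_diag -linearZ /=; congr diag_mx.
  apply/rowP => i; rewrite !mxE.
  have l0 : 0 < 1 + l i ^+ 2 by rewrite ltr_wpDr ?sqr_ge0.
  have r2 : rho i ^+ 2 = Num.sqrt (1 + l i ^+ 2) by rewrite sqr_sqrtr// sqrtr_ge0.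
  have ca : 1 = rho i ^+ 2 * cos (atan (l i)).
    by rewrite r2 cos_atan mulfV// sqrtr_eq0 -ltNge.
  have sa : l i = rho i ^+ 2 * sin (atan (l i)).
    have c0 : cos (atan (l i)) != 0.
      by rewrite gt_eqF// cos_gt0_pihalf// atan_gtNpi2 atan_ltpi2.
    have := atanK (l i); rewrite /tan => h; rewrite -{1}h.
    by rewrite -[LHS]mul1r {1}ca [sin _ / _]mulrC mulrA mulfK.
  apply: complex_ext; rewrite !ReImE /= ?ck ?sk ?cosD ?sinD.
  - by rewrite {1}sa {1}ca; ring.
  - by rewrite {1}sa {1}ca; ring.
- by move=> i; rewrite !lerD2r !lerD2l !le_atan.
- by split; [exists mx|exists mn].
- by split; [lra|apply/andP; split; lra].
Qed.
End Spectral.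

(** * Sector geometry and the final contradiction *)

Lemma common_acute_direction (R : realType) (a b : R) :
  - pi < a -> b < pi -> b - a < pi ->
  exists2 be : R, - (pi / 2) < be < pi / 2 & b - pi / 2 <= be <= a + pi / 2.
Proof.
move=> a0 b0 ab; have pi0 := @pi_gt0 R.
(* The midpoint of the intersection of the two intervals. *)
exists ((Num.max (b - pi / 2) (- (pi / 2)) + Num.min (a + pi / 2) (pi / 2)) / 2).
  by case: (leP (b - pi / 2) (- (pi / 2))); case: (leP (a + pi / 2) (pi / 2)) => ? ?; apply/andP; split; lra.
by case: (leP (b - pi / 2) (- (pi / 2))); case: (leP (a + pi / 2) (pi / 2)) => ? ?; apply/andP; split; lra.
Qed.

(** Multiplying the sum by e^(i (t - be)) puts every term in the closed right half-plane, because
    each t + th k is within pi/2 of [be]. The total would be - rho e^(- i be), whose real part is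
    negative as |be| < pi/2. *)
Lemma sector_sum_not_opposite (R : realType) n (w th : 'I_n -> R) (pmin pmax t rho : R) :
  (forall k, 0 <= w k) -> (forall k, pmin <= th k <= pmax) ->
  pmax - pmin < pi -> - pi < t + pmin -> t + pmax < pi -> 0 < rho ->
  ~ (\sum_k w k * cos (th k) = - (rho * cos t) /\
     \sum_k w k * sin (th k) = rho * sin t).
Proof.
move=> w0 thP spread lo hi rho0 [cE sE].
have [|be /andP[be1 be2] /andP[be3 be4]] := common_acute_direction lo hi; first by lra.
have cb : 0 < cos be by rewrite cos_gt0_pihalf// be1.
have : 0 <= \sum_k w k * cos (th k + (t - be)).
  apply: sumr_ge0 => k _; apply: mulr_ge0 => //; apply: cos_ge0_pihalf.
  by have /andP[? ?] := thP k; apply/andP; split; lra.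
have -> : \sum_k w k * cos (th k + (t - be)) = - (rho * cos be).
  transitivity ((\sum_k w k * cos (th k)) * cos (t - be)
                - (\sum_k w k * sin (th k)) * sin (t - be)).
    rewrite !mulr_suml -sumrB; apply: eq_bigr => k _.
    by rewrite cosD; ring.
  rewrite cE sE -[in RHS](subKr t be) [cos (t - (t - be))]cosB; ring.
by rewrite oppr_ge0 leNgt mulr_gt0.
Qed.

Lemma small_gain_le (R : realDomainType) (r s a b : R) :
  0 <= r -> 0 <= s -> s * r < 1 -> 0 <= a -> b <= s ^+ 2 * a -> r ^+ 2 * b <= a.
Proof.
move=> r0 s0 sr a0 ba; rewrite (le_trans (ler_wpM2l (sqr_ge0 r) ba))// mulrA -exprMn.
by rewrite ler_piMl// exprn_ile1 ?mulr_ge0// mulrC ltW.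
Qed.

Theorem theorem5 (R : realType) (n : nat) (A B : 'M[R[i]]_n) :
  sectorial B ->
  (exists r : R,
     [/\ 0 <= r, r_sectorial r A,
         (psi_hi r A + (phase_max B)%:E < pi%:E)%E,
         (psi_lo r A + (phase_min B)%:E > (- pi)%:E)%E &
         sigma_max B * r < 1]) ->
  (1%:M + A *m B) \in unitmx.
Proof.
move=> sB [r [r0 rA hi lo sr]].
(* Dimension 0 is settled at once; the existence lemmas used below assume [0 < n]. *)
have [n0|n_gt0] := posnP n; first by subst n; rewrite unitmxE det_mx00 unitr1.
apply: contraT => Mnu.
have [x x0 ABx] : exists2 x : 'cV[R[i]]_n, x != 0 & A *m (B *m x) = - x.
  (* [kermx] consists of row vectors, hence the passage to the transpose. *)
  move: Mnu; rewrite -unitmx_tr -row_free_unit -kermx_eq0.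
  move=> /rowV0Pn[v /sub_kermxP vM v0]; exists v^T; first by rewrite trmx_eq0.
  move/(congr1 trmx): vM; rewrite trmx_mul trmxK trmx0 mulmxDl mul1mx mulmxA.
  by move=> /eqP; rewrite addrC addr_eq0 => /eqP.
set y := B *m x in ABx.
have y0 : y != 0.
  by apply: contraNneq x0 => y0; rewrite -oppr_eq0 -ABx y0 mulmx0.
have qAy : qform A y = - Num.conj (qform B x).
  rewrite -qform_conj /qform -mulmxA ABx mulmxN [y]/(B *m x) adjmxM mxE //.
have [k k0 ky] := normalize_vector y0.
have [sB0 sBP] := sigma_max_spec B n_gt0.
have [sA0 sAP] := sigma_max_spec A n_gt0.
set z := Complex k 0 *: y in ky.
have Az : sqnorm (A *m z) = k ^+ 2 * sqnorm x.
  by rewrite /z -scalemxAr ABx sqnormZ sqnormN /= expr0n addr0.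
(* Since k^2 |y|^2 = 1, this is r^2 |y|^2 <= |x|^2 multiplied by k^2. *)
have rz : r ^+ 2 <= sqnorm (A *m z).
  have k2y : k ^+ 2 * sqnorm y = 1.
    by move: ky; rewrite sqnormZ /= expr0n addr0.
  rewrite Az -[r ^+ 2]mulr1 -k2y mulrCA ler_wpM2l ?sqr_ge0//.
  exact: small_gain_le r0 sB0 sr (sqnorm_ge0 x) (sBP x).
have Wz : Wge r A (Re (qform A z), Im (qform A z)).
  by apply/WgeP => //; exists z; split => //; case: (qform A z).
(* This selects the finite branch in [psi_lo] and [psi_hi]. *)
have rs : r <= sigma_max A.
  rewrite -(@ler_pXn2r _ 2)// ?nnegrE//.
  by rewrite (le_trans rz)// (le_trans (sAP z))// ky mulr1.
move: hi lo; rewrite /psi_hi /psi_lo rs /phase_max /phase_min.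
have [lo0 [hi0 psi0]] := psi_bounds_exist r0 (ex_intro _ _ Wz) rA.
have [pmax0 [pmin0 phase0]] := phase_bounds_exist n_gt0 sB.
(* Existence of the bounds rules out the default pair of [xget], here and for the phases. *)
case: xgetP => [[a b] _ /= psiab|noex]; last by have := noex (lo0, hi0).
case: xgetP => [[pM pm] _ /= phaseB|noex]; last by have := noex (pmax0, pmin0).
rewrite -!EFinD !lte_fin => hi lo.
have [Wang _ _ _ _] := psiab.
have [t /andP[t1 t2] [rho [rho0 /= tc ts]]] := Wang _ Wz.
have [T [th [_ BE thP _ [spread _]]]] := phaseB.
(* With these weights, k^2 x^*Bx is the sum of the w j e^(i th j). The identity z^*Az = rho e^(it)
   makes it equal to - rho e^(-it). *)
pose w j := k ^+ 2 * (Re ((T *m x) j 0) ^+ 2 + Im ((T *m x) j 0) ^+ 2).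
exfalso; apply: (@sector_sum_not_opposite R n w th pm pM t rho) => //.
- by move=> j; rewrite mulr_ge0 ?addr_ge0 ?sqr_ge0.
- by rewrite (lt_le_trans lo)// lerD2r.
- by rewrite (le_lt_trans _ hi)// lerD2r.
have qB : k ^+ 2 * Re (qform B x) = \sum_j w j * cos (th j) /\
    k ^+ 2 * Im (qform B x) = \sum_j w j * sin (th j).
  rewrite BE qform_mulmx qform_diag Re_sum Im_sum !mulr_sumr.
  by split; apply: eq_bigr => j _; rewrite /w mxE;
    move: ((T *m x) j 0) => u; rewrite !ReImE /=; ring.
have [<- <-] := qB.
move: tc ts; rewrite /z qformZ qAy; move: (qform B x) => q.
by rewrite !ReImE /= => <- <-; split; ring.
Qed.
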